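(* Let $X$ be a gauge space, let $Y$ be a compact gauge space, and let $g\colon X\to Y$ be any continuous map. Then there exists a continuous map $\bar g\colon\beta X\to Y$ such that for all $x\in X$ we have $\bar g(\check{x})\approx g(x)$. Moreover, if $h\colon\beta X\to Y$ is any other continuous map with this property (i.e. $h(\check{x})\approx g(x)$ for all $x\in X$), then for all $\xi\in\beta X$ we have $\bar g(\xi)\approx h(\xi)$.
   Context: A metric on a set $X$ is a function $d\colon X\times X\to[0,\infty)$ with $d(x,x)=0$, $d(x,y)=d(y,x)$ and $d(x,y)+d(y,z)\ge d(x,z)$ for all $x,y,z$ (so $d(x,y)=0$ with $x\ne y$ is allowed). Write $d\ge d'$ for pointwise inequality. A gauge on $X$ is a nonempty set $\mathcal{G}$ of metrics on $X$ such that for any $d_1,d_2\in\mathcal{G}$ there is $d_3\in\mathcal{G}$ with $d_3\ge d_1$ and $d_3\ge d_2$. A gauge space is a set $X$ with a gauge; the elements of the gauge are called gauge metrics or $X$-metrics. For nonempty $A,B\subseteq X$ put $d(A,B)=\inf_{a\in A,b\in B}d(a,b)$; write $A\approx B$ if $d(A,B)=0$ for all gauge metrics $d$; by convention $\emptyset\not\approx A$ for all $A$. Write $x\approx A$ for $\{x\}\approx A$, and for points $x\approx y$ means $d(x,y)=0$ for all gauge metrics $d$. A function $f\colon X\to Y$ of gauge spaces is continuous if $x\approx A$ in $X$ implies $f(x)\approx f(A)$ in $Y$, for all $x\in X$, $A\subseteq X$. A gauge space $X$ is totally bounded if for any $X$-metric $d$ and any $\varepsilon>0$, $X$ is a union of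 finitely many balls $B_d(x_i,\varepsilon)=\{y: d(y,x_i)<\varepsilon\}$. A Cauchy point $\xi$ of a gauge space $X$ consists of a function $\xi_d\colon X\to[0,\infty)$ for each gauge metric $d$, such that: (1) $d(x,y)+\xi_d(y)\ge\xi_d(x)$ for all $d,x,y$; (2) $\xi_d(x)+\xi_d(y)\ge d(x,y)$ for all $d,x,y$; (3) $\inf_{x\in X}\xi_d(x)=0$ for each $d$ (with $\inf\emptyset=+\infty$); (4) for any gauge metrics $d_1,d_2$ there is a gauge metric $d_3$ with $d_3\ge\max(d_1,d_2)$ and $\xi_{d_3}\ge\max(\xi_{d_1},\xi_{d_2})$. Each $z\in X$ gives a Cauchy point $\hat z$ with $\hat z_d(x)=d(z,x)$; $\xi$ is represented by $z$ if $\xi=\hat z$. $X$ is complete if every Cauchy point is represented by some point. $X$ is compact if it is totally bounded and complete. The completion $\widehat X$ of $X$ is the set of Cauchy points of $X$ with the gauge consisting of the metrics $\hat d(\xi,\zeta)=\inf_{x\in X}(\xi_d(x)+\zeta_d(x))$, one for each gauge metric $d$ of $X$. For a gauge space $X$, $\mathcal{G}_\beta$ is the gauge on the set $X$ consisting of all metrics $d_\varphi(x,y)=\max_{1\le i\le n}|\varphi_i(x)-\varphi_i(y)|$, for $n\in\mathbb{N}$ and $\varphi=(\varphi_1,\dots,\varphi_n)\colon X\to[0,1]^n$ continuous with respect to the given gauge on $X$, where $[0,1]^n$ has the single gauge metric $\max_i|a_i-b_i|$. The Stone–Čech compactification $\beta X$ is the completion of $(X,\mathcal{G}_\beta)$.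 For $x\in X$, $\check x\in\beta X$ denotes the Cauchy point of $(X,\mathcal{G}_\beta)$ represented by $x$. *)

(* Defs.v *)
From mathcomp Require Import all_boot all_order all_algebra.
From mathcomp Require Import boolp classical_sets cardinality reals.
From mathcomp Require Import constructive_ereal ereal.
From mathcomp Require Import lra.

Set Implicit Arguments.
Unset Strict Implicit.
Unset Printing Implicit Defensive.

Import Order.TTheory GRing.Theory Num.Theory.
Local Open Scope classical_set_scope.
Local Open Scope ring_scope.

(* Points at distance 0 need not be equal. *)
Record is_metric (R : realType) (X : Type) (d : X -> X -> R) : Prop := IsMetric {
  metric_ge0 : forall x y, 0 <= d x y;
  metricxx : forall x, d x x = 0;
  metricC : forall x y, d x y = d y x;
  metric_triangle : forall x y z, d x z <= d x y + d y z }.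

Record is_gauge (R : realType) (X : Type) (G : set (X -> X -> R)) : Prop := IsGauge {
  gauge_metric : forall d, G d -> is_metric d;
  gauge_nonempty : G !=set0;
  gauge_directed : forall d1 d2, G d1 -> G d2 ->
    exists d3, [/\ G d3, (forall x y, d1 x y <= d3 x y)
                       & (forall x y, d2 x y <= d3 x y)] }.

Record gaugeSpace (R : realType) := GaugeSpace {
  gs_sort :> Type;
  gs_gauge : set (gs_sort -> gs_sort -> R);
  gs_gaugeP : is_gauge gs_gauge }.

Definition gmetric (R : realType) (X : gaugeSpace R) : Type :=
  {d : X -> X -> R | gs_gauge d}.

Definition gmetric_fun (R : realType) (X : gaugeSpace R) (d : gmetric X) :
  X -> X -> R := sval d.
Coercion gmetric_fun : gmetric >-> Funclass.

(* Only used for nonempty A and B; the real-valued [inf] of the empty set is 0. *)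
Definition set_dist (R : realType) (X : Type) (d : X -> X -> R) (A B : set X) : R :=
  inf [set d a b | a in A & b in B].

Definition set_approx (R : realType) (X : gaugeSpace R) (A B : set X) : Prop :=
  [/\ A !=set0, B !=set0 & forall d : gmetric X, set_dist d A B = 0].

Definition pt_approx (R : realType) (X : gaugeSpace R) (x y : X) : Prop :=
  forall d : gmetric X, d x y = 0.

Definition gcontinuous (R : realType) (X Y : gaugeSpace R) (f : X -> Y) : Prop :=
  forall (x : X) (A : set X),
    set_approx [set x] A -> set_approx [set f x] (f @` A).

Definition totally_bounded (R : realType) (X : gaugeSpace R) : Prop :=
  forall (d : gmetric X) (e : R), 0 < e ->
    exists2 F : set X, finite_set F &
      \bigcup_(x in F) [set y | d y x < e] = [set: X].

(* The infimum is taken in the extended reals, where that of the empty set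
   is +oo: a gauge space without points has no Cauchy point. *)
Record is_cauchy_point (R : realType) (X : gaugeSpace R)
    (xi : gmetric X -> X -> R) : Prop := IsCauchyPoint {
  cauchy_ge0 : forall d x, 0 <= xi d x;
  cauchy_lip : forall (d : gmetric X) x y, xi d x <= d x y + xi d y;
  cauchy_triangle : forall (d : gmetric X) x y, d x y <= xi d x + xi d y;
  cauchy_inf : forall d, ereal_inf [set (xi d x)%:E | x in [set: X]] = 0%:E;
  cauchy_directed : forall d1 d2 : gmetric X, exists d3 : gmetric X,
    (forall x y, Num.max (d1 x y) (d2 x y) <= d3 x y) /\
    (forall x, Num.max (xi d1 x) (xi d2 x) <= xi d3 x) }.

Record cauchyPoint (R : realType) (X : gaugeSpace R) := CauchyPoint {
  cp_fun :> gmetric X -> X -> R;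
  cp_funP : is_cauchy_point cp_fun }.

Section CauchyPointTheory.
Variables (R : realType) (X : gaugeSpace R).
Implicit Types (d : gmetric X) (x y z : X) (xi zeta : cauchyPoint X).

Lemma gmetricP d : is_metric d.
Proof. exact: (gauge_metric (gs_gaugeP X) (svalP d)). Qed.

Lemma gmetric_directed d1 d2 : exists d3 : gmetric X,
  (forall x y, d1 x y <= d3 x y) /\ (forall x y, d2 x y <= d3 x y).
Proof.
have [d3 [G3 h1 h2]] := gauge_directed (gs_gaugeP X) (svalP d1) (svalP d2).
by exists (exist _ d3 G3).
Qed.

Lemma hat_is_cauchy_point z :
  is_cauchy_point (fun d x => (d : gmetric X) z x).
Proof.
split=> [d x|d x y|d x y|d|d1 d2].
- exact: metric_ge0 (gmetricP d) _ _.
- rewrite addrC (metricC (gmetricP d) x y).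
  exact: metric_triangle (gmetricP d) _ _ _.
- rewrite (metricC (gmetricP d) z x).
  exact: metric_triangle (gmetricP d) _ _ _.
- apply/eqP; rewrite eq_le; apply/andP; split.
    apply: ereal_inf_lbound; exists z => //.
    by rewrite (metricxx (gmetricP d)).
  apply: le_ereal_inf_tmp => _ [x _ <-].
  by rewrite lee_fin; exact: metric_ge0 (gmetricP d) _ _.
- have [d3 [h1 h2]] := gmetric_directed d1 d2; exists d3.
  by split=> *; rewrite ge_max h1 h2.
Qed.

Definition hat z : cauchyPoint X := CauchyPoint (hat_is_cauchy_point z).

Lemma cauchy_lt xi d (e : R) : 0 < e -> exists x, xi d x < e.
Proof.
move=> e0; have : (ereal_inf [set (xi d x)%:E | x in [set: X]] < e%:E)%E.
  by rewrite (cauchy_inf (cp_funP xi)) lte_fin.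
by move=> /ereal_inf_lt[_ [x _ <-]]; rewrite lte_fin; exists x.
Qed.

Lemma cauchy_homo xi d1 d2 : (forall x y, d1 x y <= d2 x y) ->
  forall x, xi d1 x <= xi d2 x.
Proof.
move=> d12 x; apply/ler_addgt0Pr => e e0.
have [d3 [_ h3]] := cauchy_directed (cp_funP xi) d1 d2.
have [y ye] := cauchy_lt xi d3 (divr_gt0 e0 (ltr0n _ 2)).
move: (h3 y); rewrite ge_max => /andP[h31 h32].
have := cauchy_lip (cp_funP xi) d1 x y.
have := cauchy_triangle (cp_funP xi) d2 x y.
have := d12 x y.
lra.
Qed.

Definition completion_dist d xi zeta : R :=
  inf [set xi d x + zeta d x | x in [set: X]].

Lemma completion_dist_le d xi zeta x :
  completion_dist d xi zeta <= xi d x + zeta d x.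
Proof.
apply: ge_inf; last by exists x.
exists 0 => _ [y _ <-].
by apply: addr_ge0; [exact: cauchy_ge0 (cp_funP xi) _ _
                    |exact: cauchy_ge0 (cp_funP zeta) _ _].
Qed.

Lemma completion_dist_ge d xi zeta (c : R) :
  (forall x, c <= xi d x + zeta d x) -> c <= completion_dist d xi zeta.
Proof.
move=> h; apply: lb_le_inf; last by move=> _ [y _ <-].
have [x _] := cauchy_lt xi d ltr01.
by exists (xi d x + zeta d x), x.
Qed.

Lemma completion_dist_metric d : is_metric (completion_dist d).
Proof.
have ge0 xi zeta : 0 <= completion_dist d xi zeta.
  apply: completion_dist_ge => x.
  by apply: addr_ge0; [exact: cauchy_ge0 (cp_funP xi) _ _
                      |exact: cauchy_ge0 (cp_funP zeta) _ _].
split=> // [xi|xi zeta|xi zeta eta].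
- apply/eqP; rewrite eq_le ge0 andbT; apply/ler_addgt0Pr => e e0.
  have [y ye] := cauchy_lt xi d (divr_gt0 e0 (ltr0n _ 2)).
  have := completion_dist_le d xi xi y.
  lra.
- by congr inf; apply: eq_imagel => x _; rewrite addrC.
- rewrite -lerBlDr; apply: completion_dist_ge => x.
  rewrite lerBlDr addrC -lerBlDr; apply: completion_dist_ge => y.
  have := completion_dist_le d xi eta y.
  have := cauchy_lip (cp_funP xi) d y x.
  have := cauchy_triangle (cp_funP zeta) d y x.
  lra.
Qed.

Definition completion_gauge : set (cauchyPoint X -> cauchyPoint X -> R) :=
  [set completion_dist d | d in [set: gmetric X]].

Lemma completion_is_gauge : is_gauge completion_gauge.
Proof.
split=> [_ [d _ <-]||_ _ [d1 _ <-] [d2 _ <-]].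
- exact: completion_dist_metric.
- have [d Gd] := gauge_nonempty (gs_gaugeP X).
  by exists (completion_dist (exist _ d Gd)); exists (exist _ d Gd).
- have [d3 [h1 h2]] := gmetric_directed d1 d2.
  exists (completion_dist d3); split; first by exists d3.
  + move=> xi zeta; apply: completion_dist_ge => x.
    apply: le_trans (completion_dist_le d1 xi zeta x) _.
    by apply: lerD; exact: cauchy_homo.
  + move=> xi zeta; apply: completion_dist_ge => x.
    apply: le_trans (completion_dist_le d2 xi zeta x) _.
    by apply: lerD; exact: cauchy_homo.
Qed.

Definition completion : gaugeSpace R := GaugeSpace completion_is_gauge.

End CauchyPointTheory.

Definition gcomplete (R : realType) (X : gaugeSpace R) : Prop :=
  forall xi : cauchyPoint X, exists z : X, xi = hat z.

Definition gcompact (R : realType) (X : gaugeSpace R) : Prop :=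
  totally_bounded X /\ gcomplete X.

Section Cube.
Variables (R : realType) (n : nat).

Definition cube : Type := {v : 'I_n -> R | forall i, 0 <= v i <= 1}.

(* All terms are nonnegative, so the default value 0 of the maximum only
   matters for n = 0, where the cube is a single point. *)
Definition cube_dist (u v : cube) : R :=
  \big[Num.max/0]_(i < n) `|sval u i - sval v i|.

Lemma cube_dist_metric : is_metric cube_dist.
Proof.
split=> [u v|u|u v|u v w].
- exact: bigmax_ge_id.
- rewrite /cube_dist; elim/big_rec: _ => // i z _ ->.
  by rewrite subrr normr0 maxxx.
- by apply: eq_bigr => i _; rewrite distrC.
- apply: bigmax_le => [|i _]; first by apply: addr_ge0; exact: bigmax_ge_id.
  apply: le_trans (ler_distD (sval v i) _ _) _.
  apply: lerD; [exact: (le_bigmax _ (fun i => `|sval u i - sval v i|))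
               |exact: (le_bigmax _ (fun i => `|sval v i - sval w i|))].
Qed.

Lemma cube_is_gauge : is_gauge [set cube_dist].
Proof.
split=> [_ ->||_ _ -> ->]; [exact: cube_dist_metric|by exists cube_dist|].
by exists cube_dist; split.
Qed.

Definition cube_space : gaugeSpace R := GaugeSpace cube_is_gauge.

End Cube.

Lemma set_dist1P (R : realType) (T : Type) (d : T -> T -> R) (x : T) (A : set T) :
  is_metric d -> A !=set0 ->
  set_dist d [set x] A = 0 <-> (forall e, 0 < e -> exists2 a, A a & d x a < e).
Proof.
move=> md [a0 Aa0]; rewrite /set_dist; set E := (X in inf X).
have E0 : E !=set0 by exists (d x a0); exists x => //; exists a0.
have lbE : lbound E 0 by move=> _ [_ -> [b _ <-]]; exact: metric_ge0.
split=> [infE e e0|h].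
  have [|_ [_ -> [a Aa <-]]] := inf_adherent e0 (E := E).
    by split=> //; exists 0.
  by rewrite infE add0r; exists a.
apply/eqP; rewrite eq_le lb_le_inf// andbT; apply/ler_addgt0Pr => e e0.
have [a Aa ae] := h e e0; rewrite add0r.
apply: le_trans (ltW ae); apply: ge_inf; first by exists 0.
by exists x => //; exists a.
Qed.

Lemma approx1P (R : realType) (X : gaugeSpace R) (x : X) (A : set X) :
  set_approx [set x] A <->
  (forall (d : gmetric X) e, 0 < e -> exists2 a, A a & d x a < e).
Proof.
split=> [[_ A0 h] d|h].
  exact/(set_dist1P x (gmetricP d) A0).
have A0 : A !=set0.
  have [d Gd] := gauge_nonempty (gs_gaugeP X).
  by have [a Aa _] := h (exist _ d Gd) 1 ltr01; exists a.
split=> //; first by exists x.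
by move=> d; apply/(set_dist1P x (gmetricP d) A0); exact: h.
Qed.

Lemma gcontinuousP (R : realType) (X Y : gaugeSpace R) (f : X -> Y) :
  gcontinuous f <->
  (forall x (d' : gmetric Y) e, 0 < e -> exists (d : gmetric X) (c : R),
     0 < c /\ forall a, d x a < c -> d' (f x) (f a) < e).
Proof.
split=> [cf x d' e e0|cf x A /approx1P xA].
  apply: contrapT => H.
  have /cf/approx1P/(_ d' e e0)[_ [a Aa <-]] :
      set_approx [set x] [set a | e <= d' (f x) (f a)].
    apply/approx1P => d c c0; apply: contrapT => H2; apply: H.
    exists d, c; split=> // a ac; rewrite ltNge; apply/negP => ea.
    by apply: H2; exists a.
  by rewrite ltNge (Aa : e <= _).
apply/approx1P => d' e e0.
have [d [c [c0 h]]] := cf x d' e e0.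
have [a Aa ac] := xA d c c0.
by exists (f a); [exists a|exact: h].
Qed.

Section Beta.
Variables (R : realType) (X : gaugeSpace R).

Definition pull_dist (n : nat) (phi : X -> cube_space R n) (x y : X) : R :=
  cube_dist (phi x) (phi y).

Definition beta_gauge : set (X -> X -> R) :=
  [set d | exists (n : nat) (phi : X -> cube_space R n),
     gcontinuous phi /\ d = pull_dist phi].

Section CubeCat.
Variables (m n : nat).

Definition cube_cat_fun (u : cube R m) (v : cube R n) (i : 'I_(m + n)) : R :=
  match split i with inl j => sval u j | inr k => sval v k end.

Lemma cube_cat_subproof u v i : 0 <= cube_cat_fun u v i <= 1.
Proof.
rewrite /cube_cat_fun; case: (split i) => j.
  exact: (svalP u j).
exact: (svalP v j).
Qed.

Definition cube_cat u v : cube R (m + n) := exist _ _ (cube_cat_subproof u v).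

Lemma cube_dist_cat u v u' v' : cube_dist (cube_cat u v) (cube_cat u' v') =
  Num.max (cube_dist u u') (cube_dist v v').
Proof.
apply/eqP; rewrite eq_le; apply/andP; split.
  apply: bigmax_le => [|i _]; first by rewrite le_max bigmax_ge_id.
  rewrite /= /cube_cat_fun le_max; case: (split i) => j; apply/orP.
  - by left; exact: (le_bigmax _ (fun i => `|sval u i - sval u' i|)).
  - by right; exact: (le_bigmax _ (fun i => `|sval v i - sval v' i|)).
rewrite ge_max; apply/andP; split.
  apply: bigmax_le => [|j _]; first exact: bigmax_ge_id.
  have := le_bigmax 0 (fun i =>
    `|cube_cat_fun u v i - cube_cat_fun u' v' i|) (lshift n j).
  by rewrite /cube_cat_fun (unsplitK (inl j)).
apply: bigmax_le => [|j _]; first exact: bigmax_ge_id.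
have := le_bigmax 0 (fun i =>
  `|cube_cat_fun u v i - cube_cat_fun u' v' i|) (rshift m j).
by rewrite /cube_cat_fun (unsplitK (inr j)).
Qed.

Lemma cube_cat_continuous (phi : X -> cube_space R m)
    (psi : X -> cube_space R n) : gcontinuous phi -> gcontinuous psi ->
  gcontinuous (fun x => cube_cat (phi x) (psi x) : cube_space R (m + n)).
Proof.
move=> /gcontinuousP cphi /gcontinuousP cpsi; apply/gcontinuousP.
move=> x [_ /= ->] e e0; rewrite /gmetric_fun /=.
have [d1 [c1 [c10 h1]]] := cphi x (exist _ _ erefl) e e0.
have [d2 [c2 [c20 h2]]] := cpsi x (exist _ _ erefl) e e0.
have [d3 [d13 d23]] := gmetric_directed d1 d2.
exists d3, (Num.min c1 c2); split; first by rewrite lt_min c10.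
move=> a; rewrite lt_min cube_dist_cat gt_max => /andP[a1 a2].
apply/andP; split; [apply: h1; exact: le_lt_trans a1
                   |apply: h2; exact: le_lt_trans a2].
Qed.

End CubeCat.

Lemma cst_continuous n (u : cube R n) :
  gcontinuous (fun _ : X => u : cube_space R n).
Proof.
apply/gcontinuousP => x d' e e0.
have [d Gd] := gauge_nonempty (gs_gaugeP X).
exists (exist _ d Gd), 1; split=> // a _.
by rewrite (metricxx (gmetricP d')).
Qed.

Lemma beta_is_gauge : is_gauge beta_gauge.
Proof.
split=> [_ [n [phi [_ ->]]]||_ _ [m [phi [cphi ->]]] [n [psi [cpsi ->]]]].
- have [h0 hxx hC ht] := cube_dist_metric R n.
  by split=> *; [exact: h0|exact: hxx|exact: hC|exact: ht].
- have u : cube R 0 by exists (fun=> 0) => i; rewrite lexx ler01.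
  exists (pull_dist (fun=> (u : cube_space R 0))), 0%N, (fun=> u).
  by split=> //; exact: cst_continuous.
- exists (pull_dist (fun x => cube_cat (phi x) (psi x) : cube_space R (m + n))).
  split; first by eexists _, _; split; first exact: cube_cat_continuous cphi cpsi.
  + by move=> x y; rewrite /pull_dist cube_dist_cat le_max lexx.
  + by move=> x y; rewrite /pull_dist cube_dist_cat le_max lexx orbT.
Qed.

Definition beta_space : gaugeSpace R := GaugeSpace beta_is_gauge.

Definition beta : gaugeSpace R := completion beta_space.

Definition check_pt (x : X) : beta := hat (x : beta_space).

End Beta.

(* Main.v *)
From mathcomp Require Import all_boot all_order all_algebra.
From mathcomp Require Import boolp classical_sets cardinality reals.
From mathcomp Require Import constructive_ereal ereal.
From mathcomp Require Import lra.
Require Import Defs.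

(** The map g is uniformly continuous from X, equipped with the metrics
    pulled back from cubes, to the totally bounded space Y: if finitely many
    balls with centres y_i cover Y, the distances to the y_i, truncated at 1
    and composed with g, are the coordinates of a continuous map from X to a
    cube, and points of X that have close images in that cube have close
    images in Y (lemma [totally_bounded_uniform]).

    A uniformly continuous map f into a complete space extends to the
    completion of its domain.  For a Cauchy point xi, the sets of points x at
    which [xi d x] is small form a filter base.  Uniform continuity makes the
    distance from y to f x settle down along that base to a number depending
    on y, these numbers form a Cauchy point of Y, and a point representing
    it is a limit of f along xi (lemmas [lim_dist_close],
    [lim_dist_is_cauchy_point] and [limit_exists]).  A modulus of uniform
    continuity for f bounds the distance between f x and that limit as soon
    as x is close to xi ([limit_close]); hence the extension is continuous
    and agrees with f on X up to distance 0.

    Conversely, a continuous map on the completion that agrees with f on the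
    represented points sends xi to a limit of f along xi
    ([continuous_limit]), and two such limits are at distance 0
    ([limit_unique]). *)

Set Implicit Arguments.
Unset Strict Implicit.
Unset Printing Implicit Defensive.

Import Order.TTheory GRing.Theory Num.Theory.
Local Open Scope classical_set_scope.
Local Open Scope ring_scope.

(** * Limits along Cauchy points *)

Section Limits.
Variables (R : realType) (Z Y : gaugeSpace R) (f : Z -> Y).
Implicit Types (xi zeta : cauchyPoint Z) (d : gmetric Z) (e : gmetric Y).

Definition gunif_continuous : Prop := forall e (eps : R), 0 < eps ->
  exists d (delta : R), 0 < delta /\
    forall x x', d x x' < delta -> e (f x) (f x') < eps.

Definition is_limit xi (z : Y) : Prop := forall e (eps : R), 0 < eps ->
  exists d (delta : R), 0 < delta /\
    forall x, xi d x < delta -> e z (f x) <= eps.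

(** By the directedness axiom of Cauchy points, the sets where [xi d] is small
    form a proper filter base, so statements that hold near xi for different
    gauge metrics can be combined at one point x. *)
Lemma cauchy_meet xi d1 d2 (c1 c2 : R) : 0 < c1 -> 0 < c2 ->
  exists x, xi d1 x < c1 /\ xi d2 x < c2.
Proof.
move=> c10 c20.
have [d3 [_ h3]] := cauchy_directed (cp_funP xi) d1 d2.
have c0 : 0 < Num.min c1 c2 by rewrite lt_min c10.
have [x] := cauchy_lt xi d3 c0; rewrite lt_min => /andP[x1 x2].
have := h3 x; rewrite ge_max => /andP[k1 k2].
by exists x; split; [exact: le_lt_trans k1 x1|exact: le_lt_trans k2 x2].
Qed.

Lemma limit_unique xi z z' : is_limit xi z -> is_limit xi z' -> pt_approx z z'.
Proof.
move=> lz lz' e; apply/eqP; rewrite eq_le (metric_ge0 (gmetricP e)) andbT.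
apply/ler_addgt0Pr => eps eps0; rewrite add0r.
have eps2 : 0 < eps / 2 by lra.
have [d1 [c1 [c10 h1]]] := lz e _ eps2.
have [d2 [c2 [c20 h2]]] := lz' e _ eps2.
have [x [x1 x2]] := cauchy_meet xi d1 d2 c10 c20.
have := h1 x x1; have := h2 x x2.
have := metric_triangle (gmetricP e) z (f x) z'.
rewrite (metricC (gmetricP e) (f x) z').
lra.
Qed.

(** A point x close to xi is close to the points x' that are much closer to
    xi, and f x' tends to z, so a modulus of continuity for f serves for the
    limit too. *)
Lemma limit_close xi z d e (delta eps : R) : is_limit xi z ->
  (forall x x', d x x' < delta -> e (f x) (f x') < eps) ->
  forall x, xi d x < delta -> e z (f x) <= eps.
Proof.
move=> lz hd x xd; apply/ler_addgt0Pr => c c0.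
have [d1 [c1 [c10 h1]]] := lz e c c0.
have dx0 : 0 < delta - xi d x by rewrite subr_gt0.
have [x' [x1 x2]] := cauchy_meet xi d1 d c10 dx0.
have xx' : d x' x < delta.
  have := cauchy_triangle (cp_funP xi) d x' x; lra.
have := hd _ _ xx'; have := h1 x' x1.
have := metric_triangle (gmetricP e) z (f x') (f x).
lra.
Qed.

(** The upper limit of the distance from y to f x as x tends to xi. *)
Definition lim_dist xi e (y : Y) : R :=
  inf [set c : R | exists d (delta : R), 0 < delta /\
                     forall x, xi d x < delta -> e y (f x) <= c].

(** The set of x found here does not depend on y: by uniform continuity f
    varies little on it, and with f x vary all the distances to f x. *)
Lemma lim_dist_close xi e (eps : R) : gunif_continuous -> 0 < eps ->
  exists d (delta : R), 0 < delta /\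
    forall x, xi d x < delta -> forall y, `|lim_dist xi e y - e y (f x)| <= eps.
Proof.
move=> uf eps0; have [d [delta [delta0 hd]]] := uf e eps eps0.
exists d, (delta / 2); split; first by lra.
move=> x xd y.
have near x' : xi d x' < delta / 2 -> `|e y (f x') - e y (f x)| <= eps.
  move=> x'd; have xx' : d x x' < delta.
    have := cauchy_triangle (cp_funP xi) d x x'; lra.
  have := hd _ _ xx'.
  have := metric_triangle (gmetricP e) y (f x) (f x').
  have := metric_triangle (gmetricP e) y (f x') (f x).
  rewrite (metricC (gmetricP e) (f x') (f x)) ler_norml => *.
  by apply/andP; split; lra.
rewrite /lim_dist; set E := (X in inf X).
have Eeps : E (e y (f x) + eps).
  exists d, (delta / 2); split; first by lra.
  by move=> x' /near; rewrite ler_norml => /andP[_]; lra.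
have lbE : lbound E (e y (f x) - eps).
  move=> c [d1 [c1 [c10 h1]]].
  have delta20 : 0 < delta / 2 by lra.
  have [x' [x1 /near]] := cauchy_meet xi d1 d c10 delta20.
  by rewrite ler_norml => /andP[+ _]; have := h1 x' x1; lra.
have inf_le : inf E <= e y (f x) + eps.
  by apply: ge_inf => //; exists (e y (f x) - eps).
have le_inf : e y (f x) - eps <= inf E.
  by apply: lb_le_inf => //; exists (e y (f x) + eps).
by rewrite ler_norml; apply/andP; split; lra.
Qed.

(** Every axiom holds up to an arbitrarily small error with [e y (f x)] in
    place of [lim_dist xi e y], for a suitable x. *)
Lemma lim_dist_is_cauchy_point xi :
  gunif_continuous -> is_cauchy_point (lim_dist xi).
Proof.
move=> uf.
have close e (eps : R) : 0 < eps ->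
    exists x, forall y, `|lim_dist xi e y - e y (f x)| <= eps.
  move=> eps0; have [d [c [c0 h]]] := lim_dist_close xi e uf eps0.
  by have [x xc] := cauchy_lt xi d c0; exists x; exact: h.
have ge0 e y : 0 <= lim_dist xi e y.
  apply/ler_addgt0Pr => eps eps0; have [x /(_ y)] := close e eps eps0.
  have := metric_ge0 (gmetricP e) y (f x).
  by rewrite ler_norml => ? /andP[? ?]; lra.
have mono e1 e2 : (forall x y, e1 x y <= e2 x y) ->
    forall y, lim_dist xi e1 y <= lim_dist xi e2 y.
  move=> e12 y; apply/ler_addgt0Pr => eps eps0.
  have eps2 : 0 < eps / 2 by lra.
  have [d1 [c1 [c10 h1]]] := lim_dist_close xi e1 uf eps2.
  have [d2 [c2 [c20 h2]]] := lim_dist_close xi e2 uf eps2.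
  have [x [x1 x2]] := cauchy_meet xi d1 d2 c10 c20.
  move: (h1 x x1 y) (h2 x x2 y); have := e12 y (f x).
  by rewrite !ler_norml => ? /andP[? ?] /andP[? ?]; lra.
split=> // [e y y'|e y y'|e|e1 e2].
- apply/ler_addgt0Pr => eps eps0; have eps2 : 0 < eps / 2 by lra.
  have [x h] := close e _ eps2; move: (h y) (h y').
  have := metric_triangle (gmetricP e) y y' (f x).
  by rewrite !ler_norml => ? /andP[? ?] /andP[? ?]; lra.
- apply/ler_addgt0Pr => eps eps0; have eps2 : 0 < eps / 2 by lra.
  have [x h] := close e _ eps2; move: (h y) (h y').
  have := metric_triangle (gmetricP e) y (f x) y'.
  rewrite (metricC (gmetricP e) (f x) y').
  by rewrite !ler_norml => ? /andP[? ?] /andP[? ?]; lra.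
- apply/eqP; rewrite eq_le; apply/andP; split; last first.
    by apply: le_ereal_inf_tmp => _ [y _ <-]; rewrite lee_fin.
  apply/lee_addgt0Pr => eps eps0; rewrite add0e.
  have [x /(_ (f x))] := close e eps eps0.
  rewrite (metricxx (gmetricP e)) subr0 => /(le_trans (ler_norm _)) hx.
  by apply: (@le_trans _ _ (lim_dist xi e (f x))%:E); rewrite ?lee_fin//;
    apply: ereal_inf_lbound; exists (f x).
- have [e3 [h1 h2]] := gmetric_directed e1 e2.
  by exists e3; split=> *; rewrite ge_max ?h1 ?h2 ?mono.
Qed.

Lemma limit_exists xi : gunif_continuous -> gcomplete Y ->
  exists z, is_limit xi z.
Proof.
move=> uf cY; have [z hz] := cY (CauchyPoint (lim_dist_is_cauchy_point xi uf)).
exists z => e eps eps0.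
have [d [c [c0 h]]] := lim_dist_close xi e uf eps0; exists d, c; split=> // x xc.
have /= zE := congr1 (fun eta : cauchyPoint Y => eta e (f x)) hz.
have := h x xc (f x); rewrite zE (metricxx (gmetricP e)) subr0.
exact: le_trans (ler_norm _).
Qed.

(** * Extension to the completion *)

(** In the completion, the distance from xi to the point represented by x is
    at most [xi d x]. *)
Lemma continuous_limit (h : completion Z -> Y) : gcontinuous h ->
  (forall x : Z, pt_approx (h (hat x)) (f x)) ->
  forall xi, is_limit xi (h xi).
Proof.
move=> /gcontinuousP ch hf xi e eps eps0.
have [[D [d dT DE]] [c [c0 hc]]] := ch xi e eps eps0.
exists d, c; split=> // x xc.
have xhat : D xi (hat x) < c.
  rewrite -DE; apply: le_lt_trans (completion_dist_le d xi (hat x) x) _.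
  by rewrite /= (metricxx (gmetricP d)) addr0.
have := hc (hat x) xhat; have := hf x e.
have := metric_triangle (gmetricP e) (h xi) (h (hat x)) (f x).
lra.
Qed.

Lemma limit_continuous (F : completion Z -> Y) : gunif_continuous ->
  (forall xi, is_limit xi (F xi)) -> gcontinuous F.
Proof.
move=> uf lF; apply/gcontinuousP => xi e eps eps0.
have eps3 : 0 < eps / 3 by lra.
have [d [delta [delta0 hd]]] := uf e _ eps3.
have Gd : gs_gauge (completion_dist d : completion Z -> completion Z -> R).
  by exists d.
exists (exist _ _ Gd), delta; split=> // zeta.
rewrite /gmetric_fun /= => close.
have [x xsum] : exists x, xi d x + zeta d x < delta.
  apply: contrapT => /forallNP far.
  move: close; rewrite ltNge => /negP; apply.
  by apply: completion_dist_ge => x; rewrite leNgt; apply/negP; exact: far.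
have := cauchy_ge0 (cp_funP xi) d x; have := cauchy_ge0 (cp_funP zeta) d x.
move=> zeta0 xi0.
have xi_lt : xi d x < delta by lra.
have zeta_lt : zeta d x < delta by lra.
have := limit_close (lF xi) hd xi_lt; have := limit_close (lF zeta) hd zeta_lt.
have := metric_triangle (gmetricP e) (F xi) (f x) (F zeta).
rewrite (metricC (gmetricP e) (f x) (F zeta)) /gmetric_fun.
lra.
Qed.

Lemma limit_hat (x : Z) z : gunif_continuous -> is_limit (hat x) z ->
  pt_approx z (f x).
Proof.
move=> uf lz e; apply/eqP; rewrite eq_le (metric_ge0 (gmetricP e)) andbT.
apply/ler_addgt0Pr => eps eps0; rewrite add0r.
have [d [delta [delta0 hd]]] := uf e eps eps0.
by apply: (limit_close lz hd); rewrite /= (metricxx (gmetricP d)).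
Qed.

Theorem completion_extension : gunif_continuous -> gcomplete Y ->
  exists fbar : completion Z -> Y,
    [/\ gcontinuous fbar,
        (forall x : Z, pt_approx (fbar (hat x)) (f x)) &
        (forall h : completion Z -> Y, gcontinuous h ->
           (forall x : Z, pt_approx (h (hat x)) (f x)) ->
           forall xi, pt_approx (fbar xi) (h xi))].
Proof.
move=> uf cY; have [F lF] := choice (fun xi => limit_exists xi uf cY).
exists F; split=> [|x|h ch hf xi].
- exact: limit_continuous.
- exact: limit_hat.
- exact: limit_unique (lF xi) (continuous_limit ch hf xi).
Qed.

End Limits.

(** * Continuous maps to totally bounded spaces *)

Section TruncatedDistances.
Variables (R : realType) (X Y : gaugeSpace R) (g : X -> Y).
Variables (e : gmetric Y) (n : nat) (y : 'I_n -> Y).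

Lemma trunc_dist_subproof x i : 0 <= Num.min 1 (e (y i) (g x)) <= 1.
Proof. by rewrite le_min ler01 (metric_ge0 (gmetricP e)) ge_min lexx. Qed.

Definition trunc_dist (x : X) : cube_space R n :=
  exist _ (fun i => Num.min 1 (e (y i) (g x))) (trunc_dist_subproof x).

Lemma min1_dist (a b : R) : `|Num.min 1 a - Num.min 1 b| <= `|a - b|.
Proof.
have := ler_norm (a - b); have := ler_norm (b - a); rewrite (distrC b a).
rewrite ler_norml !minElt; case: (ltrP 1 a); case: (ltrP 1 b) => *.
all: by apply/andP; split; lra.
Qed.

Lemma trunc_dist_continuous : gcontinuous g -> gcontinuous trunc_dist.
Proof.
move=> /gcontinuousP cg; apply/gcontinuousP => x [_ /= ->] eps eps0.
have [d [c [c0 h]]] := cg x e eps eps0; exists d, c; split=> // a ac.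
rewrite /gmetric_fun /=; apply: bigmax_lt => // i _.
apply: le_lt_trans (min1_dist _ _) _; apply: le_lt_trans (h a ac).
have := metric_triangle (gmetricP e) (y i) (g x) (g a).
have := metric_triangle (gmetricP e) (y i) (g a) (g x).
rewrite (metricC (gmetricP e) (g a) (g x)) ler_norml => *.
by apply/andP; split; lra.
Qed.

End TruncatedDistances.

(** If g x lies in the ball of radius r around y_i, then the i-th truncated
    distance is below r at x and below 2r <= 1 at nearby points x'; there it
    is the true distance, which puts g x and g x' within 3r. *)
Lemma totally_bounded_uniform (R : realType) (X Y : gaugeSpace R) (g : X -> Y) :
  totally_bounded Y -> gcontinuous g ->
  gunif_continuous (g : beta_space X -> Y).
Proof.
move=> tbY cg e eps eps0.
pose r : R := Num.min (1 / 2) (eps / 3).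
have r0 : 0 < r by rewrite lt_min; apply/andP; split; lra.
have [r2 r3] : r <= 1 / 2 /\ r <= eps / 3.
  by split; rewrite ge_min lexx ?orbT.
have [F finF coverF] := tbY e r r0.
have [s sF] := (finite_seqP (T := {classic Y}) F).1 finF.
pose y (i : 'I_(size s)) : Y := tnth (in_tuple s) i.
have Gd : gs_gauge (pull_dist (trunc_dist g e y)
    : beta_space X -> beta_space X -> R).
  by exists (size s), (trunc_dist g e y); split=> //; exact: trunc_dist_continuous.
exists (exist _ _ Gd), r; split=> // x x'; rewrite /gmetric_fun /= => xx'.
have [y0 Fy0 /= gxy0] : (\bigcup_(y in F) [set z | e z y < r]) (g x).
  by rewrite coverF.
have [i y0E] : exists i, y0 = y i.
  have /(tnthP (in_tuple s)) : (y0 : {classic Y}) \in s.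
    by move: Fy0; rewrite sF.
  by [].
have : `|Num.min 1 (e (y i) (g x)) - Num.min 1 (e (y i) (g x'))| < r.
  apply: le_lt_trans xx'.
  exact: (le_bigmax _ (fun i =>
    `|Num.min 1 (e (y i) (g x)) - Num.min 1 (e (y i) (g x'))|)).
move: gxy0; rewrite y0E (metricC (gmetricP e)) => gxi.
have := metric_triangle (gmetricP e) (g x) (y i) (g x').
rewrite (metricC (gmetricP e) (g x) (y i)).
rewrite ltr_norml !minElt /gmetric_fun.
move: gxi; rewrite /gmetric_fun; set a := sval e (y i) (g x).
set b := sval e (y i) (g x').
case: (ltrP 1 a); case: (ltrP 1 b) => ? ? ? ? /andP[? ?]; lra.
Qed.

(** * Universal property of the Stone-Cech compactification *)

Theorem theorem15p5 (R : realType) (X Y : gaugeSpace R) (hY : gcompact Y)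
    (g : X -> Y) (hg : gcontinuous g) :
  exists gbar : beta X -> Y,
    [/\ gcontinuous gbar,
        (forall x : X, pt_approx (gbar (check_pt x)) (g x)) &
        (forall h : beta X -> Y, gcontinuous h ->
           (forall x : X, pt_approx (h (check_pt x)) (g x)) ->
           forall xi : beta X, pt_approx (gbar xi) (h xi))].
Proof.
case: hY => tbY cY.
exact: completion_extension (totally_bounded_uniform tbY hg) cY.
Qed.
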